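(* Let $k \ge 2$ and $t \ge 1$ be integers, let $c_1, \dots, c_{k-1}$ be positive integers, and let $b$ be a positive integer. Let $\mathcal{E}(b)$ denote the equation \[ c_1x_1+c_2x_2+\dots+c_{k-1}x_{k-1} = x_k + b, \] and let $\mathcal{E}(0)$ denote the homogeneous equation $c_1x_1+c_2x_2+\dots+c_{k-1}x_{k-1} = x_k$. Let $s = \sum_{i=1}^{k-1} c_i - 1$. If $s \mid b$ and $\mathcal{E}(0)$ is $t$-regular, then \[ r(\mathcal{E}(b);t) \le \frac{b}{s} - \left\lceil \frac{b}{s\cdot R_C(t)} \right\rceil + 1, \] where $R_C(t) = r(\mathcal{E}(0);t)$.
   Context: For a positive integer $n$, $[1,n]=\{1,2,\dots,n\}$; a $t$-coloring of $[1,n]$ is a map from $[1,n]$ to a set of $t$ colors. A monochromatic (''mono'') solution to an equation in the variables $x_1,\dots,x_k$ is a $k$-tuple $(x_1,\dots,x_k)$ of elements of the interval, not necessarily distinct, that satisfies the equation and whose entries all have the same color. For a linear equation $\mathcal{E}$, the $t$-color Rado number $r(\mathcal{E};t)$ is the least positive integer $r$, if it exists, such that every $t$-coloring of $[1,r]$ admits a monochromatic solution to $\mathcal{E}$; if no such integer exists we set $r(\mathcal{E};t)=\infty$. The equation $\mathcal{E}$ is called $t$-regular if $r(\mathcal{E};t)$ exists (is finite). $s \mid b$ means $b = sq$ for some integer $q$; since $b>0$ this forces $s \ge 1$. *)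

(* Defs.v *)
From mathcomp Require Export all_boot all_order all_algebra.
From mathcomp Require Export boolp constructive_ereal.

Set Implicit Arguments.
Unset Strict Implicit.
Unset Printing Implicit Defensive.

Import Order.TTheory GRing.Theory Num.Theory.

Local Open Scope ring_scope.

Definition interval1 (n : nat) : Type := {i : nat | (0 < i <= n)%N}.

Definition coloring (t n : nat) : Type := interval1 n -> 'I_t.

(* An equation in k variables, given by the k-tuples of naturals satisfying it *)
Definition equation (k : nat) : Type := k.-tuple nat -> Prop.

Definition mono_solution (k t n : nat) (E : equation k) (chi : coloring t n)
    (x : k.-tuple (interval1 n)) : Prop :=
  E (map_tuple val x) /\ forall i j : 'I_k, chi (tnth x i) = chi (tnth x j).

Definition unavoidable (k : nat) (E : equation k) (t n : nat) : Prop :=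
  (0 < n)%N /\
  forall chi : coloring t n,
    exists x : k.-tuple (interval1 n), mono_solution E chi x.

(* Values lie in \bar int so that +oo is available when no such integer exists;
   -oo never occurs. *)
Definition rado_number (k : nat) (E : equation k) (t : nat) : \bar int :=
  if pselect (exists n : nat, `[< unavoidable E t n >]) is left ex
  then ((ex_minn ex)%:Z)%:E else +oo%E.

Definition regular (k : nat) (E : equation k) (t : nat) : Prop :=
  rado_number E t \is a fin_num.

(* Variables and coefficients are numbered from 0, so x_k is entry k.-1 of x. *)
Definition rado_eq (k : nat) (c : 'I_k.-1 -> nat) (b : nat) : equation k :=
  fun x => (\sum_(i < k.-1) c i * nth 0 x i = nth 0 x k.-1 + b)%N.

(* Main.v *)
Require Import Defs.
From mathcomp Require Import all_boot all_order all_algebra.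
From mathcomp Require Import boolp constructive_ereal.

Set Implicit Arguments.
Unset Strict Implicit.
Unset Printing Implicit Defensive.

Import Order.TTheory GRing.Theory Num.Theory.

Local Open Scope ring_scope.

(** Write [b = m * s] and [R = R_C(t)].  The constant [m] solves the
    inhomogeneous equation, because [(s + 1) * m = m + s * m].  Subtracting from
    this constant solution any multiple [d * y] of a solution [y] of the
    homogeneous equation gives another solution, so the reflection
    [v |-> m - d * v] carries homogeneous solutions to inhomogeneous ones.  As
    [v] runs through [[1, R]], the value [m - d * v] lies between [m - d * R] and
    [m - d].  Hence, if [d * R < m], a coloring of [[1, m - d]] pulls back along
    the reflection to a coloring of [[1, R]]; a monochromatic homogeneous
    solution for the pullback is mapped to a monochromatic solution of the
    original equation ([unavoidable_reflect]).  So the Rado number is at most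
    [m - d].

    The best choice is the largest [d] with [d * R < m], namely the quotient of
    [m - 1] by [R], which is one less than the ceiling of [m / R]
    ([ceil_divn]).  This [d] may be [0], in which case the solution obtained is
    the constant [m]. *)

Lemma rado_number_le (k : nat) (E : equation k) (t n : nat) :
  unavoidable E t n -> (rado_number E t <= (n%:Z)%:E)%E.
Proof.
move=> En; rewrite /rado_number; case: pselect => [ex|]; last first.
  by case; exists n; apply/asboolP.
by rewrite lee_fin lez_nat; case: ex_minnP => m _; apply; apply/asboolP.
Qed.

Lemma regular_unavoidable (k : nat) (E : equation k) (t : nat) :
  regular E t ->
  exists2 n : nat, rado_number E t = (n%:Z)%:E & unavoidable E t n.
Proof.
rewrite /regular /rado_number; case: pselect => // ex _.
by case: ex_minnP => n /asboolP En _; exists n.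
Qed.

(** Subtracting [d] times the homogeneous identity for [y] from the identity
    [(s + 1) * m = m + s * m] leaves the inhomogeneous identity for [x].  The
    relation between [x] and [y] is additive so that no truncated subtraction
    has to be distributed over the sum. *)
Lemma rado_eq_reflect (k : nat) (c : 'I_k.-1 -> nat) (s m d : nat)
    (y x : k.-tuple nat) :
  (0 < k)%N -> (\sum_(i < k.-1) c i = s.+1)%N ->
  (forall i, (i < k)%N -> nth 0%N x i + d * nth 0%N y i = m)%N ->
  rado_eq c 0 y -> rado_eq c (m * s) x.
Proof.
rewrite /rado_eq addn0 => k_gt0 sum_c xy Ey.
have last_lt : (k.-1 < k)%N by rewrite prednK.
have sum_xy : (\sum_(i < k.-1) c i * nth 0%N x i + d * nth 0%N y k.-1
               = s.+1 * m)%N.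
  rewrite -Ey big_distrr -big_split -sum_c big_distrl /=.
  apply: eq_bigr => i _; rewrite -(xy i) ?(ltn_trans (ltn_ord i)) //.
  by rewrite mulnDr mulnCA.
apply/eqP; rewrite -(eqn_add2r (d * nth 0%N y k.-1)) sum_xy addnAC xy //.
by rewrite mulSn mulnC.
Qed.

Lemma unavoidable_reflect (k t : nat) (c : 'I_k.-1 -> nat) (s m d R : nat) :
  (0 < k)%N -> (\sum_(i < k.-1) c i = s.+1)%N -> (d * R < m)%N ->
  unavoidable (rado_eq c 0) t R -> unavoidable (rado_eq c (m * s)) t (m - d).
Proof.
move=> k_gt0 sum_c dR_lt [R_gt0 R_unav].
have d_le : (d <= d * R)%N by rewrite leq_pmulr.
split=> [|chi]; first by rewrite subn_gt0 (leq_ltn_trans d_le).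
have dv_lt (v : interval1 R) : (d * val v < m)%N.
  apply: leq_ltn_trans dR_lt; rewrite leq_mul2l orbC.
  by case/andP: (valP v) => _ ->.
have refl_in (v : interval1 R) : (0 < m - d * val v <= m - d)%N.
  by rewrite subn_gt0 dv_lt leq_sub2l // leq_pmulr //; case/andP: (valP v).
pose refl (v : interval1 R) : interval1 (m - d) :=
  Sub (m - d * val v)%N (refl_in v).
have [y [Ey mono_y]] := R_unav (chi \o refl).
exists (map_tuple refl y); split=> [|i j]; last first.
  by rewrite !tnth_map; apply: mono_y.
apply: rado_eq_reflect Ey => // i i_lt.
have nthE n (z : k.-tuple (interval1 n)) :
    nth 0%N (map_tuple val z) i = val (tnth z (Ordinal i_lt)).
  by rewrite -tnth_map (tnth_nth 0%N).
by rewrite !nthE tnth_map; apply: subnK; apply: ltnW.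
Qed.

(** With [d] the quotient of [m - 1] by [R], one has [d * R < m <= (d + 1) * R];
    dividing by [R] characterizes the ceiling. *)
Lemma ceil_divn (m R : nat) : (0 < m)%N -> (0 < R)%N ->
  Num.ceil (m%:Q / R%:Q) = ((m.-1 %/ R).+1)%:Z.
Proof.
move=> m_gt0 R_gt0; apply: ceil_def.
have R_gt0Q : 0 < R%:Q by rewrite ltr0n.
rewrite ltr_pdivlMr // ler_pdivrMr // -[_.+1]addn1 PoszD addrK.
rewrite -!intrM ltr_int ler_int -!PoszM ltz_nat lez_nat addn1.
by rewrite -(ltn_predK m_gt0) ltnS leq_divM ltn_ceil.
Qed.

Theorem theorem7 (k t : nat) (c : 'I_k.-1 -> nat) (b : nat)
    (hk : (2 <= k)%N) (ht : (1 <= t)%N)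
    (hc : forall i : 'I_k.-1, (0 < c i)%N) (hb : (0 < b)%N) :
  let s : int := \sum_(i < k.-1) (c i)%:Z - 1 in
  let RC : int := fine (rado_number (rado_eq c 0) t) in
  (s %| b%:Z)%Z ->
  regular (rado_eq c 0) t ->
  (rado_number (rado_eq c b) t <=
     ((b%:Z %/ s)%Z - Num.ceil ((b%:Z)%:Q / (s * RC)%:Q) + 1)%:E)%E.
Proof.
move=> s RC s_dvd /regular_unavoidable[R R_def R_unav].
have {R_def}RC_def : RC = R by rewrite /RC R_def.
have R_gt0 : (0 < R)%N by case: R_unav.
have k_gt0 : (0 < k)%N := ltnW hk.
have sum_gt0 : (0 < \sum_(i < k.-1) c i)%N.
  have k1_gt0 : (0 < k.-1)%N by rewrite -ltnS prednK.
  by rewrite (bigD1 (Ordinal k1_gt0)) //= addn_gt0 hc.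
have [s' sum_c] : exists s', (\sum_(i < k.-1) c i = s'.+1)%N.
  by exists (\sum_(i < k.-1) c i).-1; rewrite prednK.
have s_def : s = s'.
  by rewrite /s -(big_morph Posz PoszD erefl) sum_c -addn1 PoszD addrK.
move: s_dvd; rewrite s_def RC_def dvdzE /= => /dvdnP[m b_def].
move: hb; rewrite b_def muln_gt0 => /andP[m_gt0 s_gt0].
have s_neq0 : s'%:Z != 0 by rewrite eqz_nat -lt0n.
set d := (m.-1 %/ R)%N.
have dR_lt : (d * R < m)%N by rewrite -(ltn_predK m_gt0) ltnS leq_divM.
have d_lt : (d < m)%N by apply: leq_ltn_trans dR_lt; rewrite leq_pmulr.
have -> : ((m * s')%N%:Z)%:Q / (s'%:Z * R%:Z)%:Q = m%:Q / R%:Q.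
  by rewrite PoszM [s'%:Z * _]mulrC !intrM -mulf_div divff ?intr_eq0 // mulr1.
rewrite PoszM mulzK // ceil_divn // -/d.
have -> : m%:Z - d.+1%:Z + 1 = (m - d)%N%:Z.
  by rewrite -subzn 1?ltnW // -addn1 PoszD opprD addrA subrK.
apply: rado_number_le; exact: (unavoidable_reflect k_gt0 sum_c dR_lt).
Qed.
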